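(* Let $n$ be a positive integer, let $B$ be any Ferrers board contained in the $n\times n$ grid, and let $0\le k\le n$. Then $$T_k(B)=\sum_{C} q^{\mathrm{mat}(C,B)},$$ where the sum is over all placements $C$ of $n$ non-attacking rooks on the $n\times n$ grid with exactly $k$ of the rooks on $B$.
   Context: Squares of the $n\times n$ grid are labelled $(i,j)$ = (row, column) as for a matrix (row $1$ at the top, column $1$ at the left). A subset $B$ of the grid is a Ferrers board if $(i,j)\in B$ implies $(k,p)\in B$ for all $1\le k\le i$ and $j\le p\le n$. $\mathrm{Area}(B)$ is the number of squares of $B$. Non-attacking means no two rooks share a row or a column. Write $[m]=(1-q^m)/(1-q)$ and $[k]!=\prod_{i=1}^k[i]$. The $q$-rook polynomial is $R_k(B)=\sum_C q^{\mathrm{inv}(C,B)}$, the sum over all placements $C$ of $k$ non-attacking rooks on squares of $B$, where $\mathrm{inv}(C,B)$ is the number of squares of $B$ that do not contain a rook, are not above a rook (in its column), and are not to the right of a rook (in its row). The $q$-hit polynomials $T_k(B)$ are defined by $$\sum_{k=0}^n [k]!\,R_{n-k}(B)\prod_{i=k+1}^n (x-q^i)=\sum_{k=0}^n T_k(B)\,x^k .$$ For a placement $C$ of $n$ non-attacking rooks on the $n\times n$ grid with exactly $k$ rooks on $B$, $\mathrm{cross}(C,B)$ is the number of squares of the $n\times n$ grid satisfying at least one of the following: (i) the square contains a rook or is to the right of a rook (in the same row); (ii) the square is above a rook (in the same column) and lies on $B$; (iii) the square is below (in the same column) a rook which is off $B$. Then $\mathrm{mat}(C,B)=n(n-k)+\mathrm{Area}(B)-\mathrm{cross}(C,B)$.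 *)

(* Defs.v *)
From mathcomp Require Import all_boot all_order all_algebra.

Set Implicit Arguments.
Unset Strict Implicit.
Unset Printing Implicit Defensive.

Import GRing.Theory.

(* Rows and columns are numbered from 0: (i, j) is the square in row i (row 0
   at the top) and column j (column 0 at the left). *)
Notation square n := ('I_n * 'I_n)%type.

Definition ferrers (n : nat) (B : {set square n}) : Prop :=
  forall i j k p : 'I_n, (i, j) \in B -> k <= i -> j <= p -> (k, p) \in B.

Definition nonattacking (n : nat) (C : {set square n}) : bool :=
  [forall r in C, forall r' in C,
     (r != r') ==> (r.1 != r'.1) && (r.2 != r'.2)].

Definition above (n : nat) (s r : square n) : bool :=
  (s.2 == r.2) && (s.1 < r.1).

Definition below (n : nat) (s r : square n) : bool :=
  (s.2 == r.2) && (r.1 < s.1).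

Definition right_of (n : nat) (s r : square n) : bool :=
  (s.1 == r.1) && (r.2 < s.2).

Definition inv (n : nat) (C B : {set square n}) : nat :=
  #|[set s in B | [&& s \notin C,
                      ~~ [exists r in C, above s r]
                    & ~~ [exists r in C, right_of s r]]]|.

Definition cross (n : nat) (C B : {set square n}) : nat :=
  #|[set s : square n |
      [|| (s \in C) || [exists r in C, right_of s r],
          [exists r in C, above s r] && (s \in B)
        | [exists r in C, below s r && (r \notin B)]]]|.

Local Open Scope ring_scope.

(* The number k of rooks on B is read off C; the value is an integer, so the
   subtraction is not truncated. *)
Definition mat (n : nat) (C B : {set square n}) : int :=
  n%:Z * (n%:Z - #|C :&: B|%:Z) + #|B|%:Z - (cross C B)%:Z.

(* The field Q(q) of rational functions in an indeterminate q, where the quotient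
   in qnum and the powers q ^ m, m : int, make sense without side conditions. *)
Notation Qq := {fraction {poly rat}}.

Definition q : Qq := tofrac 'X.

Definition qnum (m : nat) : Qq := (1 - q ^+ m) / (1 - q).

Definition qfact (k : nat) : Qq := \prod_(1 <= i < k.+1) qnum i.

Definition qrook (n : nat) (B : {set square n}) (k : nat) : Qq :=
  \sum_(C : {set square n} | [&& C \subset B, #|C| == k & nonattacking C])
    q ^+ inv C B.

Definition qhit_gen (n : nat) (B : {set square n}) : {poly Qq} :=
  \sum_(0 <= k < n.+1)
    (qfact k * qrook B (n - k)) *:
      \prod_(k.+1 <= i < n.+1) ('X - (q ^+ i)%:P).

Definition qhit (n : nat) (B : {set square n}) (k : nat) : Qq :=
  (qhit_gen B)`_k.

(* No term beyond x^n, so the qhit B k satisfy their defining identity. *)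
Lemma qhit_genE (n : nat) (B : {set square n}) :
  qhit_gen B = \sum_(0 <= k < n.+1) qhit B k *: 'X^k.
Proof.
have sz : (size (qhit_gen B) <= n.+1)%N.
  apply/(leq_trans (size_sum _ _ _))/bigmax_leqP_seq => k + _.
  rewrite mem_index_iota => /andP[_ ltkn].
  apply: (leq_trans (size_scale_leq _ _)).
  rewrite size_prod_XsubC size_iota ltnS subSS.
  exact: leq_subr.
rewrite big_mkord -poly_def; apply/polyP => i; rewrite coef_poly.
case: ltnP => // /(leq_trans sz) ?; exact: nth_default.
Qed.

(* Main.v *)
Require Import Defs.
From mathcomp Require Import all_boot all_order all_algebra.
From mathcomp Require Import ring zify.
From Stdlib Require Import FunctionalExtensionality.

(* Follow the boundary of B from the top left to the bottom right corner of
   the grid. When the part of the grid met so far is the rectangle of h rows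
   and j columns, let V be the vector whose c-th entry sums q^stat x^(rooks on
   B) over the partial placements leaving c of the j columns empty. A step
   across a row applies to V an operator D, a step across a column an operator
   U_{h,j}: a rook on B is placed when its column is met, a rook off B when
   its row is met. These operators satisfy U_{h+1,j} D = q D U_{h,j} + K_h,
   and the operators K_h pass through both kinds of steps: D K_h = K_{h+1} D
   and U_{h+1,j+1} K_h = K_h U_{h,j}. Hence each placement of m rooks on B
   counted by the q-rook polynomial contributes to V the vector K_{h-1} ...
   K_{h-m} D^{h-m} e_{j-m}. On the zeroth entry K_h acts as multiplication by
   x - q^{h+1}, which at h = j = n produces the product [n-m]! (x - q^{n-m+1})
   ... (x - q^n) of the definition of the q-hit numbers. *)

Set Implicit Arguments.
Unset Strict Implicit.
Unset Printing Implicit Defensive.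

Import Order.TTheory GRing.Theory Num.Theory.
Local Open Scope ring_scope.

(** * The transfer operators *)

Section Operators.

Variables (R : comNzRingType) (q qi x : R).
Hypothesis qqi : q * qi = 1.

(** The q-number $[m]$ as a sum rather than a quotient, so that it makes sense in any commutative
    ring. *)
Definition gnum (m : nat) : R := \sum_(i < m) q ^+ i.

Lemma gnum0 : gnum 0 = 0. Proof. exact: big_ord0. Qed.

Lemma gnumS m : gnum m.+1 = 1 + q * gnum m.
Proof.
rewrite /gnum big_ord_recl expr0 mulr_sumr; congr (_ + _).
by apply: eq_bigr => i _; rewrite exprS.
Qed.

Lemma gnumD m k : gnum (m + k) = gnum m + q ^+ m * gnum k.
Proof.
elim: m => [|m IH]; first by rewrite gnum0 add0r expr0 mul1r.
by rewrite addSn !gnumS IH exprS; ring.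
Qed.

(** Used to trade powers of [q] for q-numbers, after which the operator identities are polynomial
    identities within reach of [ring]. *)
Lemma exprq_gnum m : q ^+ m = 1 - (1 - q) * gnum m.
Proof.
by elim: m => [|m IH]; rewrite ?gnum0 ?gnumS ?exprS ?IH ?expr0; ring.
Qed.

Lemma exprqqi m : q ^+ m * qi ^+ m = 1.
Proof. by rewrite -exprMn qqi expr1n. Qed.

Definition shift (v : nat -> R) (c : nat) : R := if c is c'.+1 then v c' else 0.

Definition dirac (e c : nat) : R := (c == e)%:R.

(** First term: a rook goes into one of [c.+1] empty columns, with weights $1, q, \dots, q^c$.
    Second term: the row stays empty and its [c] free squares each weigh [q]. *)
Definition rowop (v : nat -> R) (c : nat) : R :=
  gnum c.+1 * v c.+1 + q ^+ c * v c.

(* Equals q^-c times the q-number of h - j + c (see colcoefE), written without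
   the subtraction in nat so that colop_cornerop holds for all h, j and c. *)
Definition colcoef (h j c : nat) : R :=
  qi ^+ c * gnum c + qi ^+ j * (gnum h - gnum j).

(** First term: the new column receives a rook on the board, whence the factor [x]. Second term: it
    stays empty, which adds one empty column and [h] squares of the board. *)
Definition colop (h j : nat) (v : nat -> R) (c : nat) : R :=
  x * colcoef h j c * v c + q ^+ h * shift v c.

(* K_h stands for the deletion of a corner square of the board together with its
   row and its column. *)
Definition cornerop (h : nat) (v : nat -> R) (c : nat) : R :=
  x * v c
  - q ^+ h.+1 * (q ^+ c * v c - (1 - q) * shift (fun d => q ^+ d * v d) c).

(** In the application [r] counts the free rows, [t] the rooks and [c] the empty columns. *)
Lemma colcoefE r c t : colcoef (r + t) (c + t) c = qi ^+ c * gnum r.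
Proof.
rewrite /colcoef ![(_ + t)%N]addnC !gnumD exprD.
have -> : gnum t + q ^+ t * gnum r - (gnum t + q ^+ t * gnum c)
        = q ^+ t * (gnum r - gnum c) by ring.
rewrite [qi ^+ t * _]mulrC -mulrA [qi ^+ t * _]mulrA [qi ^+ t * _]mulrC exprqqi.
by ring.
Qed.

Lemma colcoefSS h j c : colcoef h.+1 j.+1 c = colcoef h j c.
Proof.
rewrite /colcoef !gnumS exprS; congr (_ + _).
transitivity (q * qi * (qi ^+ j * (gnum h - gnum j))); first by ring.
by rewrite qqi mul1r.
Qed.

Lemma rowop_cornerop h v : rowop (cornerop h v) = cornerop h.+1 (rowop v).
Proof.
apply: functional_extensionality => -[|c].
  by rewrite /rowop /cornerop /= !gnumS gnum0 !exprS; ring.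
rewrite /rowop /cornerop /= !exprS !gnumS (exprq_gnum c).
ring.
Qed.

Lemma colcoefS h j c : colcoef h j c.+1 = colcoef h j c + qi ^+ c.+1.
Proof.
rewrite /colcoef gnumS exprS.
transitivity (q * qi * qi ^+ c * gnum c + qi * qi ^+ c
  + qi ^+ j * (gnum h - gnum j)); first by ring.
by rewrite qqi; ring.
Qed.

Lemma shift_exprq v c :
  q * shift (fun d => q ^+ d * v d) c = q ^+ c * shift v c.
Proof. by case: c => [|c] /=; rewrite ?mulr0 // exprS mulrA. Qed.

Lemma colop_cornerop h j v :
  colop h.+1 j.+1 (cornerop h v) = cornerop h (colop h j v).
Proof.
apply: functional_extensionality => -[|c];
  rewrite /colop /cornerop /= !colcoefSS.
  by rewrite exprS; ring.
have E := shift_exprq v c; have I := exprqqi c.+1.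
rewrite colcoefS.
set w := shift _ c in E *; set u := shift _ c in E *.
(* The difference of the two sides is a combination of the relations [I] and [E], which [ring]
   cannot use on its own; it only has to check the combination. *)
apply/eqP; rewrite -subr_eq0.
set a := colcoef h j c; set b := qi ^+ c.+1 in I *.
rewrite [X in X == 0](_ : _ =
  (1 - q) * q ^+ h * x * v c * (q ^+ c.+1 * b - 1)
  + (1 - q) * q ^+ h * q ^+ h.+1 * (q * w - q ^+ c * u)); last first.
  by rewrite !exprS; ring.
by rewrite I E !subrr !mulr0 addr0.
Qed.

(** With $r = h - j + c$ both sides are $q^{-c}[r+1]$. *)
Lemma colcoefSl h j c : colcoef h.+1 j c = q * colcoef h j c.+1.
Proof.
apply/eqP; rewrite -subr_eq0.
rewrite [X in X == 0](_ : _ = qi ^+ c * gnum c - q * qi * qi ^+ c * gnum c.+1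
  + qi ^+ j * (1 - (1 - q) * gnum j)); last by rewrite /colcoef gnumS exprS;
    ring.
rewrite qqi -exprq_gnum [qi ^+ j * _]mulrC exprqqi -(addn1 c) gnumD.
rewrite [gnum 1]gnumS gnum0 mulr0 addr0 mulr1 mul1r.
rewrite mulrDr [qi ^+ c * q ^+ c]mulrC exprqqi.
by apply/eqP; ring.
Qed.

Lemma colop_rowop h j v c :
  colop h.+1 j (rowop v) c = q * rowop (colop h j v) c + cornerop h v c.
Proof.
(* With $r = h - j + c$ this is $[r+1] = q[r] + 1$; the summand 1 is the source of the term
   $K_h$. *)
have E : q ^+ c * colcoef h.+1 j c = q * q ^+ c * colcoef h j c + 1.
  rewrite colcoefSl colcoefS mulrDr mulrDr !mulrA -exprSr.
  by rewrite exprqqi -exprS.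
apply/eqP; rewrite -subr_eq0.
rewrite [X in X == 0](_ : _ =
  x * v c * (q ^+ c * colcoef h.+1 j c - (q * q ^+ c * colcoef h j c + 1))
  + (colcoef h.+1 j c - q * colcoef h j c.+1) * x * gnum c.+1 * v c.+1).
  by rewrite E colcoefSl !subrr !(mulr0, mul0r) addr0.
rewrite /colop /rowop /cornerop; case: c {E} => [|c] /=.
  by rewrite !gnumS gnum0 !exprS; ring.
by rewrite !gnumS !exprS (exprq_gnum c); ring.
Qed.

(* psi s e m is K_{s+m-1} ... K_s D^s e_e. *)
Fixpoint psi (s e m : nat) : nat -> R :=
  if m is m'.+1 then cornerop (s + m') (psi s e m') else iter s rowop (dirac e).

Lemma rowop_psi s e m : rowop (psi s e m) = psi s.+1 e m.
Proof. by elim: m => //= m IH; rewrite rowop_cornerop IH. Qed.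

Lemma rowopD a b v w :
  rowop (fun c => a * v c + b * w c) = fun c => a * rowop v c + b * rowop w c.
Proof. by apply: functional_extensionality => c; rewrite /rowop; ring. Qed.

Lemma corneropD h a b v w :
  cornerop h (fun c => a * v c + b * w c)
  = fun c => a * cornerop h v c + b * cornerop h w c.
Proof.
apply: functional_extensionality => -[|c]; rewrite /cornerop /=; ring.
Qed.

Lemma rowop_sum (I : finType) (P : pred I) (a : I -> R) (v : I -> nat -> R) c :
  rowop (fun d => \sum_(i | P i) a i * v i d) c = \sum_(i | P i) a i * rowop (v
    i) c.
Proof.
rewrite /rowop !mulr_sumr -big_split /=.
by apply: eq_bigr => i _; ring.
Qed.

Lemma colop_sum (I : finType) (P : pred I) (a : I -> R) (v : I -> nat -> R) h j
  c :
  colop h j (fun d => \sum_(i | P i) a i * v i d) c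
  = \sum_(i | P i) a i * colop h j (v i) c.
Proof.
case: c => [|c]; rewrite /colop /=.
  by rewrite mulr0 addr0 mulr_sumr; apply: eq_bigr => i _; ring.
by rewrite !mulr_sumr -big_split /=; apply: eq_bigr => i _; ring.
Qed.

(** Induction on [s]: moving the column operator past one row operator multiplies by [q] and adds
    one copy of $K_s D^s e_e$, so the coefficient follows $[s+1] = 1 + q[s]$. *)
Lemma colop_iter_rowop s e :
  colop s e (iter s rowop (dirac e))
  = fun c => gnum s * psi s.-1 e 1 c + q ^+ s * psi s e.+1 0 c.
Proof.
elim: s => [|s IH]; apply: functional_extensionality => c.
  rewrite gnum0 mul0r add0r !expr0 /= /colop /dirac.
  rewrite expr0 mul1r; case: (c =P e) => [->|_].
    (* The coefficient is 0: a column of height 0 has no square for a rook. *)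
    have := colcoefE 0 e 0; rewrite add0n addn0 gnum0 mulr0 => ->.
    by rewrite mulr0 mul0r add0r; case: e => [|e] /=; rewrite mul1r ?ltn_eqF.
  by rewrite mulr0 add0r mul1r; case: c.
rewrite iterS colop_rowop IH rowopD /= addn0.
(* For [s = 0] the truncated [s.-1] gives the wrong vector, but the factor $[0]$ removes it. *)
have -> : gnum s * rowop (cornerop s.-1 (iter s.-1 rowop (dirac e))) c
        = gnum s * cornerop s (iter s rowop (dirac e)) c.
  by case: s {IH} => [|s]; rewrite ?gnum0 ?mul0r // rowop_cornerop.
by rewrite gnumS exprS /= addn0; ring.
Qed.

(** The column operator passes through all [m] corner operators and then meets the case without
    rooks. The two terms match the two choices for a new column in the q-rook polynomial: a further
    rook on one of [s] free squares, or none. *)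
Lemma colop_psi s e m :
  colop (s + m) (e + m) (psi s e m)
  = fun c => gnum s * psi s.-1 e m.+1 c + q ^+ s * psi s e.+1 m c.
Proof.
elim: m => [|m IH]; first by rewrite !addn0; exact: colop_iter_rowop.
rewrite !addnS [psi s e _]/= colop_cornerop IH corneropD.
apply: functional_extensionality => c; congr (_ + _).
case: s {IH} => [|s]; first by rewrite gnum0 !mul0r.
by rewrite /= addnS.
Qed.

(** At entry 0 each corner operator is multiplication by $x - q^{h+1}$. To come from entry [e] to
    entry 0 in [e] row steps, the index must drop at every step, which yields $[e]!$. *)
Lemma psi0 e m :
  psi e e m 0 = \prod_(i < e) gnum i.+1 * \prod_(e.+1 <= i < (e + m).+1) (x - q
    ^+ i).
Proof.
elim: m => [|m IH].
  rewrite addn0 big_geq // mulr1 /=.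
  (* Vanishing below [e] replaces being a unit vector, since [rowop] preserves such a property (with
     the bound lowered by one) while it spreads a unit vector over two entries. *)
  suff H v : (forall c, (c < e)%N -> v c = 0) ->
      iter e rowop v 0%N = (\prod_(i < e) gnum i.+1) * v e.
    rewrite H => [|c lt_ce]; rewrite /dirac ?eqxx ?mulr1 //.
    by rewrite ltn_eqF.
  elim: e v => [|e IH] v v0; first by rewrite big_ord0 mul1r.
  rewrite iterSr IH => [|c lt_ce]; rewrite /rowop.
    by rewrite (v0 e) // mulr0 addr0 big_ord_recr mulrA.
  by rewrite !v0 ?mulr0 ?addr0 // ltnS ltnW.
rewrite /= addnS big_nat_recr /=; last by rewrite ltnS leq_addr.
by rewrite mulrA -IH /cornerop /= expr0; ring.
Qed.

End Operators.

(** * Placements on the union of a board and a line *)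

(** Listed by increasing [f], the elements of [A] have ranks $0, 1, \dots, |A|-1$. The induction
    removes the last one, which leaves the other ranks unchanged. *)
Lemma sum_expr_rank (R : comNzRingType) (a : R) (T : finType) (f : T -> nat)
    (A : {set T}) :
  {in A &, injective f} ->
  \sum_(s in A) a ^+ #|[set t in A | (f t < f s)%N]| = gnum a #|A|.
Proof.
move En: #|A| => m; elim: m A En => [|m IH] A En injf.
  by rewrite (cards0_eq En) big_set0 gnum0.
have [s0 s0A] : exists s, s \in A by apply/card_gt0P; rewrite En.
pose s1 := [arg max_(s > s0 in A) f s].
have [s1A s1max] : s1 \in A /\ forall t, t \in A -> (f t <= f s1)%N.
  by rewrite /s1; case: arg_maxnP.
have lt_s1 t : t \in A :\ s1 -> (f t < f s1)%N.
  rewrite 2!inE => /andP[nts tA]; rewrite ltn_neqAle s1max // andbT.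
  by apply: contra nts => /eqP/injf ->.
have cA : #|A :\ s1| = m by move: (cardsD1 s1 A); rewrite s1A En; case.
rewrite (big_setD1 s1) //= addrC -(addn1 m) gnumD gnumS gnum0 mulr0 addr0 mulr1.
congr (_ + _); last first.
  congr (_ ^+ _); rewrite -cA; apply: eq_card => t; rewrite [LHS]inE.
  apply/andP/idP => [[tA lts]|tA]; last by rewrite lt_s1 //; case/setD1P: tA.
  by rewrite !inE tA andbT; apply: contraTneq lts => ->; rewrite ltnn.
rewrite -(IH _ cA); last by move=> u v /setD1P[_ uA] /setD1P[_ vA]; apply: injf.
apply: eq_bigr => s sA; congr (_ ^+ _); apply: eq_card => t; rewrite !inE.
case: eqP => //= ->; rewrite s1A /=.
by rewrite ltnNge (ltnW (lt_s1 _ sA)).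
Qed.

Lemma eq_exists_in (T : finType) (C : {set T}) (P Q : pred T) :
  {in C, P =1 Q} -> [exists r in C, P r] = [exists r in C, Q r].
Proof.
by move=> eqPQ; apply: eq_existsb => r; case: (boolP (r \in C)) => // /eqPQ ->.
Qed.

Lemma exists_in_setU1 (T : finType) (s : T) (C : {set T}) (P : pred T) :
  [exists r in s |: C, P r] = P s || [exists r in C, P r].
Proof.
apply/existsP/orP => [[r /andP[/setU1P[->|rC] Pr]]|[Ps|/existsP[r /andP[rC
  Pr]]]].
- by left.
- by right; apply/existsP; exists r; rewrite rC.
- by exists s; rewrite setU11.
- by exists r; rewrite setU1r.
Qed.

Lemma exists_in_eq0 (T : finType) (C : {set T}) (P : pred T) :
  (forall r, r \in C -> ~~ P r) -> [exists r in C, P r] = false.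
Proof.
by move=> P0; apply/existsP => -[r /andP[/P0/negP]].
Qed.

Section Placements.

Variable n : nat.
Implicit Types (C A L : {set square n}) (s : square n).

Definition attacked s C := [exists r in C, (s.1 == r.1) || (s.2 == r.2)].

Lemma nonattackingP C :
  reflect {in C &, forall r r', r != r' -> (r.1 != r'.1) && (r.2 != r'.2)}
          (nonattacking C).
Proof.
apply: (iffP 'forall_in_forall_inP) => [H r r' rC r'C|H r rC r' r'C].
  by move/(_ r rC r' r'C): H => /implyP.
by apply/implyP; apply: H.
Qed.

Lemma nonattacking_setU1 s C : s \notin C ->
  nonattacking (s |: C) = nonattacking C && ~~ attacked s C.
Proof.
move=> sC; apply/nonattackingP/andP => [H|[/nonattackingP H sf]].
  split.
    by apply/nonattackingP => r r' rC r'C; apply: H; apply: setU1r.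
  apply/existsP => -[r /andP[rC]]; apply/negP; rewrite negb_or.
  apply: H; rewrite ?setU11 ?setU1r //.
  by apply: contraNneq sC => ->.
have sfree r : r \in C -> (s.1 != r.1) && (s.2 != r.2).
  by move=> rC; rewrite -negb_or; apply: contra sf => E; apply/existsP;
    exists r; rewrite rC.
move=> r r' /setU1P[->|rC] /setU1P[->|r'C]; rewrite ?eqxx //.
- by move=> _; apply: sfree.
- by move=> _; rewrite eq_sym [r.2 == _]eq_sym; apply: sfree.
- exact: H.
Qed.

(* When any two squares of L attack each other, a placement has at most one rook
   on L. *)
Lemma sum_nonattacking_line (V : nmodType) A L (p : pred nat)
    (F : {set square n} -> V) :
  [disjoint A & L] ->
  {in L &, forall s s', (s.1 == s'.1) || (s.2 == s'.2)} ->
  \sum_(C | [&& nonattacking C, C \subset A :|: L & p #|C|]) F C =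
  \sum_(C | [&& nonattacking C, C \subset A & p #|C|]) F C +
  \sum_(C | [&& nonattacking C, C \subset A & p #|C|.+1])
    \sum_(s in L | ~~ attacked s C) F (s |: C).
Proof.
move=> dAL lineL.
have AL s : s \in A -> s \in L -> False by move=> sA sL;
  move/disjointFr: dAL => /(_ _ sA); rewrite sL.
have lineE C s s' : nonattacking C -> s \in C -> s' \in C -> s \in L -> s' \in
  L -> s' = s.
  move=> /nonattackingP naC sC s'C sL s'L; apply/eqP; apply: contraT => ns.
  by have := naC _ _ s'C sC ns; rewrite -negb_or lineL.
rewrite (bigID (fun C => C \subset A)) /=; congr (_ + _).
  apply: eq_bigl => C; rewrite -!andbA; congr (_ && _).
  case sA: (C \subset A); rewrite ?andbF // andbT.
  by rewrite (subset_trans sA (subsetUl _ _)).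
(* The inner sum has one term if [C] leaves [A], by [lineE], and none if [C] stays inside [A]; so it
   selects the placements with a rook on [L] and marks that rook. *)
transitivity (\sum_(C | [&& nonattacking C, C \subset A :|: L & p #|C|])
   \sum_(s in L | s \in C) F C).
  rewrite [RHS](bigID (fun C => C \subset A)) /= [X in X + _]big1 ?add0r.
    apply: eq_bigr => C /andP[/and3P[naC sC _] nsA].
    have /subsetPn[s sC' sA] := nsA.
    have sL : s \in L by have := subsetP sC _ sC'; rewrite inE (negPf sA).
    rewrite (big_pred1 s) // => t /=; apply/andP/eqP => [[tL tC]|->//].
    exact: (lineE C).
  move=> C /andP[_ /subsetP sA]; apply: big1 => s /andP[sL /sA sA'].
  by case: (AL _ sA' sL).
rewrite (exchange_big_dep (mem L)) /=; last by move=> C s _ /andP[].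
rewrite [RHS](exchange_big_dep (mem L)) /=; last by move=> C s _ /andP[].
apply: eq_bigr => s sL.
have sAn C : C \subset A -> s \notin C by move=> /subsetP sA;
  apply/negP => /sA /AL; apply.
(* Removing the marked rook is a bijection onto the placements on [A] that do not attack its
   square. *)
rewrite (reindex_onto (fun C => s |: C) (fun C => C :\ s)) /=; last first.
  by move=> C /andP[_ /andP[_ sC]]; rewrite setD1K.
apply: eq_bigl => C; rewrite setU11 sL /= andbT.
case: (boolP (s \in C)) => sC.
  rewrite [_ :\ _ == C](introF eqP) ?andbF.
    by apply/esym/negP => /andP[/and3P[_ /sAn]]; rewrite sC.
  by move=> E; move: sC; rewrite -E !inE eqxx.
rewrite setU1K // eqxx andbT nonattacking_setU1 // cardsU1 sC add1n.
case: (boolP (nonattacking C)) => //= naC.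
case: (boolP (attacked s C)) => //= sf; rewrite ?andbF ?andbT //.
congr (_ && _); apply/idP/idP => [/subsetP sCA|sCA].
  apply/subsetP => r rC; have := sCA r (setU1r _ rC);
    rewrite inE => /orP[//|rL].
  case/negP: sf; apply/existsP; exists r; rewrite rC /=.
  exact: lineL.
by apply/subsetP => r /setU1P[->|/(subsetP sCA) rA]; rewrite inE ?sL ?orbT ?rA.
Qed.

End Placements.

(** * Appending a row or a column *)

Section Lines.

Variable n : nat.
Implicit Types (C A L B : {set square n}) (s r : square n).

Definition rect (h j : nat) : {set square n} :=
  [set s : square n | (s.1 < h)%N && (s.2 < j)%N].

Definition rowline (h : 'I_n) (j : nat) : {set square n} :=
  [set s : square n | (s.1 == h) && (s.2 < j)%N].

Definition colline (h : nat) (j : 'I_n) : {set square n} :=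
  [set s : square n | (s.1 < h)%N && (s.2 == j)].

Lemma rectSrow (h : 'I_n) j : rect h.+1 j = rect h j :|: rowline h j.
Proof.
by apply/setP => s; rewrite !inE -andb_orl ltnS leq_eqVlt orbC.
Qed.

Lemma rectScol h (j : 'I_n) : rect h j.+1 = rect h j :|: colline h j.
Proof.
by apply/setP => s; rewrite !inE -andb_orr ltnS [(s.2 <= j)%N]leq_eqVlt orbC.
Qed.

Lemma rect_rowline (h : 'I_n) j : [disjoint rect h j & rowline h j].
Proof.
rewrite -setI_eq0; apply/eqP/setP => s; rewrite !inE.
by case: (s.1 =P h) => [->|_]; rewrite ?ltnn ?andbF.
Qed.

Lemma rect_colline h (j : 'I_n) : [disjoint rect h j & colline h j].
Proof.
rewrite -setI_eq0; apply/eqP/setP => s; rewrite !inE.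
by case: (s.2 =P j) => [->|_]; rewrite ?ltnn ?andbF.
Qed.

Lemma rowline_attack (h : 'I_n) j :
  {in rowline h j &, forall s s', (s.1 == s'.1) || (s.2 == s'.2)}.
Proof. by move=> s s'; rewrite !inE => /andP[/eqP-> _] /andP[/eqP-> _];
  rewrite eqxx. Qed.

Lemma colline_attack h (j : 'I_n) :
  {in colline h j &, forall s s', (s.1 == s'.1) || (s.2 == s'.2)}.
Proof. by move=> s s'; rewrite !inE => /andP[_ /eqP->] /andP[_ /eqP->];
  rewrite eqxx orbT. Qed.

Lemma card_ord_lt h : (h <= n)%N -> #|[set i : 'I_n | (i < h)%N]| = h.
Proof.
move=> le_hn; rewrite -sum1dep_card -(big_ord_widen n (fun=> 1%N) le_hn).
by rewrite sum1_card card_ord.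
Qed.

Lemma card_rows C : nonattacking C -> #|[set r.1 | r in C]| = #|C|.
Proof.
move=> /nonattackingP H; apply: card_in_imset => r r' rC r'C eq1.
by apply/eqP; apply: contraT => /(H _ _ rC r'C); rewrite eq1 eqxx.
Qed.

Lemma card_cols C : nonattacking C -> #|[set r.2 | r in C]| = #|C|.
Proof.
move=> /nonattackingP H; apply: card_in_imset => r r' rC r'C eq2.
by apply/eqP; apply: contraT => /(H _ _ rC r'C); rewrite eq2 eqxx andbF.
Qed.

Lemma attacked_rowline C (h : 'I_n) j s : C \subset rect h j -> s \in rowline h
  j ->
  attacked s C = (s.2 \in [set r.2 | r in C]).
Proof.
move=> /subsetP sC; rewrite inE => /andP[/eqP s1 _].
apply/existsP/imsetP => [[r /andP[rC /orP[/eqP E|/eqP E]]]|[r rC E]].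
- by move: (sC _ rC); rewrite inE -E s1 ltnn.
- by exists r.
- by exists r; rewrite rC E eqxx orbT.
Qed.

Lemma attacked_colline C h (j : 'I_n) s : C \subset rect h j -> s \in colline h
  j ->
  attacked s C = (s.1 \in [set r.1 | r in C]).
Proof.
move=> /subsetP sC; rewrite inE => /andP[_ /eqP s2].
apply/existsP/imsetP => [[r /andP[rC /orP[/eqP E|/eqP E]]]|[r rC E]].
- by exists r.
- by move: (sC _ rC); rewrite inE -E s2 ltnn andbF.
- by exists r; rewrite rC E eqxx.
Qed.

Definition freerow h j C := [set s in rowline h j | ~~ attacked s C].
Definition freecol h j C := [set s in colline h j | ~~ attacked s C].

(** The rooks lie above the row, so each attacks exactly one of its squares, in pairwise distinct
    columns. *)
Lemma card_freerow C (h : 'I_n) j : (j <= n)%N -> nonattacking C ->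
  C \subset rect h j -> (#|freerow h j C| + #|C| = j)%N.
Proof.
move=> le_jn naC sC; rewrite -[RHS](card_ord_lt le_jn) -(card_cols naC).
set J := [set i : 'I_n | _]; set K := [set r.2 | r in C].
have sKJ : K \subset J.
  apply/subsetP => i /imsetP[r rC ->]; move: (subsetP sC _ rC).
  by rewrite !inE => /andP[].
have -> : freerow h j C = [set (h, i) | i in J :\: K].
  apply/setP => s; apply/idP/imsetP => [|[i]].
    rewrite inE => /andP[sL]; rewrite (attacked_rowline sC sL) => sK.
    exists s.2; first by rewrite 2!inE sK; move: sL; rewrite inE => /andP[].
    by move: sL; rewrite inE => /andP[/eqP <- _]; case: s {sK}.
  rewrite 2!inE => /andP[iK iJ] E.
  have sL : s \in rowline h j by rewrite E inE eqxx.
  by rewrite inE sL (attacked_rowline sC sL) E.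
rewrite card_imset => [|i i' []//].
by rewrite cardsD (setIidPr sKJ) subnK // subset_leq_card.
Qed.

Lemma card_freecol C h (j : 'I_n) : (h <= n)%N -> nonattacking C ->
  C \subset rect h j -> (#|freecol h j C| + #|C| = h)%N.
Proof.
move=> le_hn naC sC; rewrite -[RHS](card_ord_lt le_hn) -(card_rows naC).
set J := [set i : 'I_n | _]; set K := [set r.1 | r in C].
have sKJ : K \subset J.
  apply/subsetP => i /imsetP[r rC ->]; move: (subsetP sC _ rC).
  by rewrite !inE => /andP[].
have -> : freecol h j C = [set (i, j) | i in J :\: K].
  apply/setP => s; apply/idP/imsetP => [|[i]].
    rewrite inE => /andP[sL]; rewrite (attacked_colline sC sL) => sK.
    exists s.1; first by rewrite 2!inE sK; move: sL; rewrite inE => /andP[].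
    by move: sL; rewrite inE => /andP[_ /eqP <-]; case: s {sK}.
  rewrite 2!inE => /andP[iK iJ] E.
  have sL : s \in colline h j by rewrite E inE eqxx andbT.
  by rewrite inE sL (attacked_colline sC sL) E.
rewrite card_imset => [|i i' []//].
by rewrite cardsD (setIidPr sKJ) subnK // subset_leq_card.
Qed.

Lemma card_colline h (j : 'I_n) : (h <= n)%N -> #|colline h j| = h.
Proof.
move=> le_hn; rewrite -[RHS](@card_freecol set0 h j) ?sub0set //.
  rewrite cards0 addn0; apply: eq_card => s; rewrite !inE.
  by rewrite /attacked exists_in_eq0 ?andbT // => r; rewrite inE.
by apply/nonattackingP => r r'; rewrite inE.
Qed.

(* stat extends mat to partial placements on the rectangle of h rows and j
   columns in such a way that appending a line leaves the contribution of the
   old squares unchanged (see mat_stat). *)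
Definition skipped h j C B := [set s in rect h j :\: B |
  [&& s \notin C, ~~ [exists r in C, below s r] & ~~ [exists r in C, right_of s
    r]]].

(** For a full placement on a Ferrers board these are, in the columns whose rook is on the board,
    the squares that [cross] counts only because they are above a rook. *)
Definition passed C B := [set s | [exists r in C :&: B, above s r]
                              && ~~ [exists r in C, right_of s r]].

Definition stat h j C B : int := #|B :&: rect h j|%:Z + #|skipped h j C B|%:Z
  - (\sum_(s in C :&: B) s.2.+1)%:Z - #|passed C B|%:Z.

Lemma cardsU_disj (T : finType) (P Q S : {set T}) :
  P \subset S -> [disjoint S & Q] -> #|P :|: Q| = (#|P| + #|Q|)%N.
Proof.
move=> sPS dSQ; rewrite cardsU disjoint_setI0 ?cards0 ?subn0 //.
exact: disjointWl sPS dSQ.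
Qed.

Lemma gt_ord_eqF (i j : 'I_n) : (i < j)%N -> (j == i) = false.
Proof. by move=> lt_ij; rewrite -val_eqE gtn_eqF. Qed.

Lemma skipped_sub h j C B : skipped h j C B \subset rect h j.
Proof. by apply/subsetP => s; rewrite inE => /andP[/setDP[]]. Qed.

(** * Appending a row off the board *)

Section Row.
Variables (h : 'I_n) (j : nat) (B C : {set square n}).
Hypotheses (offB : [disjoint rowline h j & B]) (sC : C \subset rect h j).

Let CP r : r \in C -> (r.1 < h)%N /\ (r.2 < j)%N.
Proof. by move/(subsetP sC); rewrite inE => /andP[]. Qed.

Lemma freerow_sub : freerow h j C \subset rowline h j.
Proof. by apply/subsetP => s; rewrite inE => /andP[]. Qed.

(** All rooks lie above the new row, so none stands to the left within it, and to be below a rook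
    there is to be attacked. *)
Lemma skipped_row : skipped h.+1 j C B = skipped h j C B :|: freerow h j C.
Proof.
apply/setP => s; rewrite 2!inE [RHS]inE [in RHS]inE [s \in _ :\: _]inE.
rewrite [s \in freerow _ _ _]inE rectSrow inE.
case: (boolP (s \in rowline h j)) => sL; last by rewrite !orbF.
rewrite (disjointFr offB sL) orbT (disjointFl (rect_rowline h j) sL) /=.
have s1 : s.1 = h by move: sL; rewrite inE => /andP[/eqP].
have -> : s \in C = false by apply/negP => /CP[]; rewrite s1 ltnn.
rewrite [X in _ && ~~ X]exists_in_eq0 => [|r /CP[lt_rh _]]; last first.
  by rewrite /right_of s1 gt_ord_eqF.
rewrite andbT /=; congr (~~ _); apply: eq_exists_in => r /CP[lt_rh _].
by rewrite /below s1 lt_rh andbT [h == _]gt_ord_eqF.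
Qed.

(** In its row the new rook takes away [s] and the free squares to its right; earlier rows do not
    see it. *)
Lemma skipped_row1 s : s \in rowline h j ->
  skipped h.+1 j (s |: C) B
  = skipped h j C B :|: [set t in freerow h j C | (t.2 < s.2)%N].
Proof.
move=> sL; apply/setP => t.
have s1 : s.1 = h by move: sL; rewrite inE => /andP[/eqP].
(* [skipped_row] is read as an equation for the membership of [t], so that only the effect of [s] on
   the conditions is left to examine. *)
have := congr1 (fun A : {set square n} => t \in A) skipped_row.
rewrite !in_setU [t \in skipped h.+1 _ _ _]inE [in X in _ -> X = _]inE.
rewrite !exists_in_setU1 in_setU1 /=.
rewrite [t \in [set _ in freerow _ _ _ | _]]inE => E.
case: (boolP (t \in rowline h j)) => tL; last first.
  have tF : (t \in freerow h j C) = false by apply: contraNF tL;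
    apply: (subsetP freerow_sub).
  rewrite tF /= orbF in E *; rewrite -E; apply: andb_id2l.
  rewrite rectSrow !inE => /andP[_ tR].
  have lt_th : (t.1 < h)%N.
    by move: tR tL; rewrite inE; case: (t.1 < h)%N => //= ->.
  have -> : t == s = false by apply: contraTF lt_th => /eqP ->; rewrite s1 ltnn.
  have -> : below t s = false by rewrite /below s1 ltnNge (ltnW lt_th) andbF.
  by rewrite /right_of s1 [t.1 == h]eq_sym gt_ord_eqF.
have t1 : t.1 = h by move: tL; rewrite inE => /andP[/eqP].
have tN : (t \in skipped h j C B) = false.
  by apply: contraTF tL => /(subsetP (skipped_sub _ _ _ _)) /(disjointFr
    (rect_rowline h j)) ->.
rewrite tN /= in E *; rewrite -E -andbA; congr (_ && _).
have -> : below t s = false by rewrite /below s1 t1 ltnn andbF.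
rewrite /right_of s1 t1 eqxx /= ltnNge.
have -> : (t == s) = (val t.2 == val s.2).
  by rewrite val_eqE -pair_eqE /pair_eq t1 s1 eqxx.
rewrite !negb_or -andbA; case: (t \notin C); rewrite ?andbF //=.
rewrite (negbK (_ <= _)%N) [RHS]andbC [in RHS]ltn_neqAle -andbA; congr (_ && _).
by rewrite andbCA.
Qed.

Lemma passed_row s : s \in rowline h j -> passed (s |: C) B = passed C B.
Proof.
move=> sL; have s1 : s.1 = h by move: sL; rewrite inE => /andP[/eqP].
apply/setP => t; rewrite !inE setIUl (_ : [set s] :&: B = set0); last first.
  apply/setP => u; rewrite !inE; apply/andP => -[/eqP ->].
  by rewrite (disjointFr offB).
rewrite set0U exists_in_setU1; apply: andb_id2l => /existsP[r
  /andP[/setIP[/CP[lt_rh _] _]]].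
move=> /andP[_ lt_tr]; have lt_th := ltn_trans lt_tr lt_rh.
by rewrite /right_of s1 [t.1 == h]eq_sym gt_ord_eqF.
Qed.

Lemma setI_row s : s \in rowline h j -> (s |: C) :&: B = C :&: B.
Proof.
move=> sL; rewrite setIUl (_ : [set s] :&: B = set0) ?set0U //.
apply/setP => u; rewrite !inE; apply/andP => -[/eqP ->].
by rewrite (disjointFr offB).
Qed.

Lemma rectI_row : B :&: rect h.+1 j = B :&: rect h j.
Proof.
rewrite rectSrow setIUr (_ : B :&: rowline h j = set0) ?setU0 //.
by apply/eqP; rewrite setI_eq0 disjoint_sym.
Qed.

Lemma stat_row : stat h.+1 j C B = stat h j C B + #|freerow h j C|%:Z.
Proof.
rewrite /stat rectI_row skipped_row (cardsU_disj (S := rect h j)) ?skipped_sub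
  //.
  by rewrite PoszD; ring.
rewrite disjoint_sym; apply: disjointWl freerow_sub _.
by rewrite disjoint_sym rect_rowline.
Qed.

Lemma stat_row1 s : s \in rowline h j ->
  stat h.+1 j (s |: C) B
  = stat h j C B + #|[set t in freerow h j C | (t.2 < s.2)%N]|%:Z.
Proof.
move=> sL; rewrite /stat rectI_row skipped_row1 // passed_row // setI_row //.
rewrite (cardsU_disj (S := rect h j)) ?skipped_sub //.
  by rewrite PoszD; ring.
rewrite disjoint_sym; apply: (@disjointWl _ _ (mem (rowline h j))).
  by apply/subsetP => t; rewrite inE => /andP[/(subsetP freerow_sub)].
by rewrite disjoint_sym rect_rowline.
Qed.

End Row.

(** * Appending a column on the board *)

Section Column.
Variables (h : nat) (j : 'I_n) (B C : {set square n}).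
Hypotheses (onB : colline h j \subset B) (sC : C \subset rect h j) (le_hn : (h
  <= n)%N).

Let CP r : r \in C -> (r.1 < h)%N /\ (r.2 < j)%N.
Proof. by move/(subsetP sC); rewrite inE => /andP[]. Qed.

Lemma rectD_col : rect h j.+1 :\: B = rect h j :\: B.
Proof.
by rewrite rectScol setDUl (_ : colline h j :\: B = set0) ?setU0 //;
  apply/eqP; rewrite setD_eq0.
Qed.

Lemma skipped_col : skipped h j.+1 C B = skipped h j C B.
Proof. by rewrite /skipped rectD_col. Qed.

Lemma skipped_col1 s : s \in colline h j ->
  skipped h j.+1 (s |: C) B = skipped h j C B.
Proof.
rewrite inE => /andP[_ /eqP s2].
apply/setP => t; rewrite /skipped rectD_col [LHS]inE [RHS]inE; apply: andb_id2l.
rewrite !inE => /andP[_ /andP[_ lt_tj]].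
rewrite !exists_in_setU1 /below /right_of s2 [t.2 == j]eq_sym (gt_ord_eqF
  lt_tj).
rewrite [(j < t.2)%N]ltnNge (ltnW lt_tj) andbF /= -pair_eqE /pair_eq s2.
by rewrite [t.2 == j]eq_sym (gt_ord_eqF lt_tj) andbF.
Qed.

Lemma freecol_sub : freecol h j C \subset colline h j.
Proof. by apply/subsetP => s; rewrite inE => /andP[]. Qed.

Lemma passed_sub : passed C B \subset rect h j.
Proof.
apply/subsetP => t; rewrite !inE => /andP[/existsP[r /andP[/setIP[/CP[? ?]
  _]]]].
by move=> /andP[/eqP -> ?] _; rewrite (ltn_trans _ (n := r.1)).
Qed.

(** The old rooks stand left of the new column, so a square above [s] has a rook to its left exactly
    when [C] attacks it. Old squares are left of [s] and in other columns, hence unaffected. *)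
Lemma passed_col1 s : s \in colline h j ->
  passed (s |: C) B = passed C B :|: [set t in freecol h j C | (t.1 < s.1)%N].
Proof.
move=> sL; have sB := subsetP onB _ sL.
have [lt_sh s2] : (s.1 < h)%N /\ s.2 = j by move: sL;
  rewrite inE => /andP[? /eqP].
apply/setP => t; rewrite [LHS]inE setIUl (setIidPl _) ?sub1set //.
rewrite !exists_in_setU1 in_setU.
rewrite [t \in passed _ _]inE [t \in [set _ in _ | _]]inE [t \in freecol _ _
  _]inE.
case: (boolP (t \in colline h j)) => tL.
  have t2 : t.2 = j by move: tL; rewrite inE => /andP[_ /eqP].
  rewrite [X in _ || X]exists_in_eq0 => [|r /setIP[/CP[_ lt_rj] _]]; last first.
    by rewrite /above t2 gt_ord_eqF.
  rewrite [X in (X && _) || _]exists_in_eq0 => [|r /setIP[/CP[_ lt_rj] _]];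
    last first.
    by rewrite /above t2 gt_ord_eqF.
  rewrite orbF orFb /above /right_of t2 s2 eqxx ltnn andbF /= andbC.
  congr (~~ _ && _); apply: eq_exists_in => r /CP[_ lt_rj].
  by rewrite t2 lt_rj andbT [j == _]gt_ord_eqF // orbF.
rewrite andFb orbF.
have -> : above t s = false.
  apply: contraNF tL => /andP[/eqP E lt]; rewrite inE E s2 eqxx andbT.
  exact: ltn_trans lt lt_sh.
rewrite orFb; apply: andb_id2l => /existsP[r /andP[/setIP[/CP[_ lt_rj] _]]].
by move=> /andP[/eqP E _]; rewrite /right_of E s2 [(j < _)%N]ltnNge (ltnW
  lt_rj) andbF.
Qed.

Lemma card_passed_col1 s : s \in colline h j ->
  #|passed (s |: C) B|
  = (#|passed C B| + #|[set t in freecol h j C | (t.1 < s.1)%N]|)%N.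
Proof.
move=> sL; rewrite passed_col1 // (cardsU_disj (S := rect h j)) ?passed_sub //.
rewrite disjoint_sym; apply: (@disjointWl _ _ (mem (colline h j))).
  by apply/subsetP => t; rewrite inE => /andP[/(subsetP freecol_sub)].
by rewrite disjoint_sym rect_colline.
Qed.

Lemma card_rectI_col : #|B :&: rect h j.+1| = (#|B :&: rect h j| + h)%N.
Proof.
rewrite rectScol setIUr (setIidPr onB) (cardsU_disj (S := rect h j)) ?subsetIr
  //.
  by rewrite card_colline.
exact: rect_colline.
Qed.

Lemma stat_col : stat h j.+1 C B = stat h j C B + h%:Z.
Proof. by rewrite /stat card_rectI_col skipped_col PoszD; ring. Qed.

Lemma notin_col s : s \in colline h j -> s \notin C.
Proof.
rewrite inE => /andP[_ /eqP s2]; apply/negP => /CP[_].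
by rewrite s2 ltnn.
Qed.

Lemma stat_col1 s : s \in colline h j ->
  stat h j.+1 (s |: C) B = stat h j C B + h%:Z - j.+1%:Z
    - #|[set t in freecol h j C | (t.1 < s.1)%N]|%:Z.
Proof.
move=> sL; have sB := subsetP onB _ sL.
have s2 : s.2 = j by move: sL; rewrite inE => /andP[_ /eqP].
rewrite /stat card_rectI_col skipped_col1 // card_passed_col1 //.
rewrite setIUl (setIidPl (_ : [set s] \subset B)) ?sub1set // big_setU1 /=;
  last first.
  by rewrite inE (negPf (notin_col sL)).
by rewrite s2 !PoszD; ring.
Qed.

Lemma rectI_col : B :&: rect h j.+1 = (B :&: rect h j) :|: colline h j.
Proof. by rewrite rectScol setIUr (setIidPr onB). Qed.

(** The new column holds no rook, so [inv] counts those of its squares without a rook to the left,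
    which are the unattacked ones. *)
Lemma inv_col :
  Defs.inv C (B :&: rect h j.+1) = (Defs.inv C (B :&: rect h j) + #|freecol h j
    C|)%N.
Proof.
rewrite /Defs.inv rectI_col -(cardsU_disj (S := rect h j)); first last.
- by rewrite disjoint_sym (disjointWl freecol_sub) // disjoint_sym rect_colline.
- by apply/subsetP => t; rewrite inE => /andP[/setIP[]].
congr #|pred_of_set _|; apply/setP => t; rewrite [LHS]inE [RHS]inE [in RHS]inE.
rewrite [t \in freecol _ _ _]inE in_setU;
  case: (boolP (t \in colline h j)) => tL; last by rewrite !orbF.
have t2 : t.2 = j by move: tL; rewrite inE => /andP[_ /eqP].
have -> : (t \in B :&: rect h j) = false.
  by rewrite inE (disjointFl (rect_colline h j) tL) andbF.
rewrite (negPf (notin_col tL)) /=.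
rewrite [X in ~~ X && _]exists_in_eq0 => [|r /CP[_ lt_rj]]; last first.
  by rewrite /above t2 gt_ord_eqF.
congr (~~ _); apply: eq_exists_in => r /CP[_ lt_rj].
by rewrite /right_of t2 lt_rj andbT [j == _]gt_ord_eqF // orbF.
Qed.

(** Of the unattacked squares of the column, the rook excludes its own square and those above it. *)
Lemma inv_col1 s : s \in colline h j ->
  Defs.inv (s |: C) (B :&: rect h j.+1)
  = (Defs.inv C (B :&: rect h j) + #|[set t in freecol h j C | (s.1 <
    t.1)%N]|)%N.
Proof.
move=> sL; have s2 : s.2 = j by move: sL; rewrite inE => /andP[_ /eqP].
rewrite /Defs.inv rectI_col -(cardsU_disj (S := rect h j)); first last.
- rewrite disjoint_sym; apply: (@disjointWl _ _ (mem (colline h j))).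
    by apply/subsetP => t; rewrite inE => /andP[/(subsetP freecol_sub)].
  by rewrite disjoint_sym rect_colline.
- by apply/subsetP => t; rewrite inE => /andP[/setIP[]].
congr #|pred_of_set _|; apply/setP => t; rewrite [LHS]inE [RHS]inE [in RHS]inE.
rewrite [t \in [set _ in freecol _ _ _ | _]]inE [t \in freecol _ _ _]inE
  in_setU.
rewrite !exists_in_setU1 in_setU1.
case: (boolP (t \in colline h j)) => tL.
  have t2 : t.2 = j by move: tL; rewrite inE => /andP[_ /eqP].
  have -> : (t \in B :&: rect h j) = false.
    by rewrite inE (disjointFl (rect_colline h j) tL) andbF.
  rewrite (negPf (notin_col tL)) /= orbF.
  rewrite [X in _ || X]exists_in_eq0 => [|r /CP[_ lt_rj]]; last first.
    by rewrite /above t2 gt_ord_eqF.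
  rewrite {1}/right_of /above s2 t2 eqxx ltnn andbF orbF /= andbA andbC.
  congr (~~ _ && _).
    apply: eq_exists_in => r /CP[_ lt_rj].
    by rewrite /right_of t2 lt_rj andbT [j == _]gt_ord_eqF // orbF.
  rewrite -leqNgt ltn_neqAle; congr (~~ _ && _).
  apply/eqP/eqP => [-> //|/val_inj E].
  by rewrite (surjective_pairing t) (surjective_pairing s) E s2 t2.
rewrite !orbF; apply: andb_id2l => /setIP[_]; rewrite inE => /andP[_ lt_tj].
have -> : t == s = false by apply: contraTF lt_tj => /eqP->; rewrite s2 ltnn.
by rewrite /above /right_of s2 [t.2 == j]eq_sym (gt_ord_eqF lt_tj) [(j <
  _)%N]ltnNge (ltnW lt_tj) andbF.
Qed.

End Column.
End Lines.

(** * Generating functions along the boundary path *)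

Section Transfer.

Variables (R : comUnitRingType) (q x : R) (n : nat) (B : {set square n}).
Hypothesis q_unit : q \is a GRing.unit.
Implicit Types (C : {set square n}) (s : square n).

Lemma card_rect_cols h j C :
  (j <= n)%N -> nonattacking C -> C \subset rect n h j -> (#|C| <= j)%N.
Proof.
move=> le_jn naC sC; rewrite -(card_cols naC) -[leqRHS](card_ord_lt le_jn).
apply: subset_leq_card; apply/subsetP => i /imsetP[r /(subsetP sC)].
by rewrite !inE => /andP[_ ?] ->.
Qed.

Lemma card_rect_rows h j C :
  (h <= n)%N -> nonattacking C -> C \subset rect n h j -> (#|C| <= h)%N.
Proof.
move=> le_hn naC sC; rewrite -(card_rows naC) -[leqRHS](card_ord_lt le_hn).
apply: subset_leq_card; apply/subsetP => i /imsetP[r /(subsetP sC)].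
by rewrite !inE => /andP[? _] ->.
Qed.

Lemma freerow_inj (h : 'I_n) j C : {in freerow h j C &, injective (fun t => val
  t.2)}.
Proof.
move=> s t; rewrite !inE => /andP[/andP[/eqP s1 _] _] /andP[/andP[/eqP t1 _] _]
  /val_inj E.
by rewrite (surjective_pairing t) (surjective_pairing s) E s1 t1.
Qed.

Lemma freecol_inj h (j : 'I_n) C : {in freecol h j C &, injective (fun t => val
  t.1)}.
Proof.
move=> s t; rewrite !inE => /andP[/andP[_ /eqP s2] _] /andP[/andP[_ /eqP t2] _]
  /val_inj E.
by rewrite (surjective_pairing t) (surjective_pairing s) E s2 t2.
Qed.

Lemma sum_freerow (h : 'I_n) j C :
  \sum_(s in freerow h j C) q ^+ #|[set t in freerow h j C | (t.2 < s.2)%N]|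
  = gnum q #|freerow h j C|.
Proof. exact: (sum_expr_rank q (@freerow_inj h j C)). Qed.

Lemma sum_freecol h (j : 'I_n) C :
  \sum_(s in freecol h j C) q ^+ #|[set t in freecol h j C | (s.1 < t.1)%N]|
  = gnum q #|freecol h j C|.
Proof.
(* The exponent counts free squares below [s], so the order of the rows is reversed before ranks are
   taken. *)
rewrite -(@sum_expr_rank _ q _ (fun t => n - val t.1)%N) => [|s t sF tF].
  apply: eq_bigr => s _; congr (_ ^+ _); apply: eq_card => t.
  by rewrite inE [RHS]inE (ltn_sub2lE _ (ltnW (ltn_ord t.1))).
move/(congr1 (subn n)); rewrite !subKn ?(ltnW (ltn_ord _)) //.
exact: (freecol_inj sF tF).
Qed.

Lemma card_freecol_rank h (j : 'I_n) C s : s \in freecol h j C ->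
  (#|[set t in freecol h j C | (t.1 < s.1)%N]|
   + #|[set t in freecol h j C | (s.1 < t.1)%N]|).+1 = #|freecol h j C|.
Proof.
move=> sF; rewrite [RHS](cardsD1 s) sF add1n; congr _.+1.
rewrite -[RHS](cardsID [set t : square n | (t.1 < s.1)%N]).
congr (_ + _)%N; apply: eq_card => t; rewrite [LHS]inE [RHS]inE.
  rewrite in_setD1 [X in _ = _ && X]inE; case: (t =P s) => [->|_] //=.
  by rewrite ltnn !andbF.
rewrite in_setD1 [X in _ = ~~ X && _]inE -leqNgt andbA [RHS]andbC.
case: (boolP (t \in freecol h j C)) => //= tF; rewrite ltn_neqAle andbC.
congr (_ && ~~ _); apply/eqP/eqP => [E|->//].
by apply: (freecol_inj tF sF).
Qed.

Definition weight h j C : R := q ^ stat h j C B * x ^+ #|C :&: B|.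

Definition fullgen h j (c : nat) : R :=
  \sum_(C | [&& nonattacking C, C \subset rect n h j & (#|C| + c == j)%N])
    weight h j C.

(** The conjunct [true] gives the index set the shape required by [sum_nonattacking_line] with the
    predicate [predT]. *)
Definition rookgen h j (c : nat) : R :=
  \sum_(C | [&& nonattacking C, C \subset B :&: rect n h j & true])
    q ^+ Defs.inv C (B :&: rect n h j)
    * psi q x (h - #|C|) (j - #|C|) #|C| c.

Lemma expqz (m : int) k : q ^ (m + k%:Z) = q ^+ k * q ^ m.
Proof. by rewrite exprzDr // mulrC. Qed.

(** A placement leaving [d] of the [j] columns empty has [d] unattacked squares in the new row. To
    end with [c] empty columns, [d] is [c.+1] if a rook is added and [c] otherwise. *)
Lemma fullgen_row (h : 'I_n) j : (j <= n)%N -> [disjoint rowline h j & B] ->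
  fullgen h.+1 j = rowop q (fullgen h j).
Proof.
move=> le_jn offB; apply: functional_extensionality => c.
rewrite /fullgen rectSrow.
rewrite (sum_nonattacking_line (fun m => (m + c == j)%N)
  _ (rect_rowline h j) (@rowline_attack n h j)).
rewrite /rowop addrC !mulr_sumr; congr (_ + _).
  apply: eq_big => [C|C /and3P[naC sC /eqP Ec]]; first by rewrite addSnnS.
  have cF : #|freerow h j C| = c.+1.
    by apply: (@addIn #|C|); rewrite (card_freerow le_jn naC sC) -Ec addSnnS
      addnC.
  rewrite -cF -sum_freerow.
  rewrite mulr_suml; apply: eq_big => [s|s /andP[sL _]];
    first by rewrite [RHS]inE.
  by rewrite /weight stat_row1 // expqz (setI_row _ offB sL) mulrA.
apply: eq_bigr => C /and3P[naC sC /eqP Ec].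
have cF : #|freerow h j C| = c.
  by apply: (@addIn #|C|); rewrite (card_freerow le_jn naC sC) -Ec addnC.
by rewrite /weight stat_row // cF expqz mulrA.
Qed.

Lemma fullgen_col h (j : 'I_n) : (h <= n)%N -> colline h j \subset B ->
  fullgen h j.+1 = colop q q^-1 x h j (fullgen h j).
Proof.
move=> le_hn onB; apply: functional_extensionality => c.
rewrite /fullgen rectScol.
rewrite (sum_nonattacking_line (fun m => (m + c == j.+1)%N)
  _ (rect_colline h j) (@colline_attack n h j)).
rewrite /colop addrC; congr (_ + _).
  rewrite mulr_sumr; apply: eq_big => [C|C /and3P[naC sC /eqP Ec]];
    first by rewrite addSn eqSS.
  have cF := card_freecol le_hn naC sC.
  have -> : colcoef q q^-1 h j c = q^-1 ^+ c * gnum q #|freecol h j C|.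
    have ej : (j : nat) = (c + #|C|)%N by lia.
    by rewrite ej -[in LHS]cF colcoefE //; exact: divrr.
  rewrite -sum_freecol.
  rewrite mulr_sumr mulr_sumr mulr_suml.
  apply: eq_big => [s|s /andP[sL sF]]; first by rewrite [RHS]inE.
  have sFr : s \in freecol h j C by rewrite inE sL.
  rewrite /weight stat_col1 // setIUl (setIidPl (_ : [set s] \subset B));
    last first.
    by rewrite sub1set (subsetP onB).
  rewrite cardsU1 inE (negPf (notin_col sC sL)) /= exprS.
  have Eab := card_freecol_rank sFr.
  set a := #|[set t in freecol h j C | (t.1 < s.1)%N]| in Eab *.
  set b := #|[set t in freecol h j C | (s.1 < t.1)%N]| in Eab *.
  (* The free squares number $a + b + 1 = h - |C|$ and $j = |C| + c$, so $h - (j+1) - a = b - c$: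
     the sum over [s] becomes $q^{-c}$ times a q-number. *)
  have Es : stat h j C B + h%:Z - j.+1%:Z - a%:Z = stat h j C B - c%:Z + b%:Z.
    lia.
  rewrite Es expqz exprzDr // -exprnN -exprVn.
  by move: (q ^ _) (q^-1 ^+ c) (q ^+ b) (x ^+ _) => u v w z; ring.
(* With no empty column allowed and no rook in the new one, [j.+1] rooks would have to fit in [j]
   columns; the value 0 of [shift] at 0 agrees with this. *)
case: c => [|c] /=.
  rewrite mulr0; apply: big1 => C /and3P[naC sC /eqP Ec].
  by move: (card_rect_cols (ltnW (ltn_ord j)) naC sC);
    rewrite -ltnS -Ec addn0 ltnn.
rewrite mulr_sumr; apply: eq_big => [C|C /and3P[naC sC _]].
  by rewrite addnS eqSS.
by rewrite /weight stat_col // expqz mulrA.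
Qed.

Lemma rookgen_row (h : 'I_n) j : (j <= n)%N -> [disjoint rowline h j & B] ->
  rookgen h.+1 j = rowop q (rookgen h j).
Proof.
move=> le_jn offB; apply: functional_extensionality => c.
rewrite rowop_sum /rookgen (rectI_row offB);
  apply: eq_bigr => C /and3P[naC sC _].
have le_Ch := card_rect_rows (ltnW (ltn_ord h)) naC (subset_trans sC (subsetIr
  _ _)).
by rewrite rowop_psi subSn.
Qed.

(** The two terms of [colop_psi] correspond to placements with and without a rook in the new column:
    [inv] grows by the rank of the rook among the free squares, counted from below, or by the number
    of all free squares. *)
Lemma rookgen_col h (j : 'I_n) : (h <= n)%N -> colline h j \subset B ->
  rookgen h j.+1 = colop q q^-1 x h j (rookgen h j).
Proof.
move=> le_hn onB; apply: functional_extensionality => c.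
rewrite colop_sum /rookgen [in LHS](eq_bigl (fun C =>
  [&& nonattacking C, C \subset (B :&: rect n h j) :|: colline h j & predT
    #|C|])); last first.
  by move=> C; rewrite (rectI_col onB).
rewrite (sum_nonattacking_line predT _ _ (@colline_attack n h j)); last first.
  exact: disjointWl (subsetIr _ _) (rect_colline h j).
rewrite addrC -big_split /=; apply: eq_bigr => C /and3P[naC sCB _].
have sC := subset_trans sCB (subsetIr _ _).
have le_Ch := card_rect_rows le_hn naC sC.
have le_Cj := card_rect_cols (ltnW (ltn_ord j)) naC sC.
have := colop_psi x (divrr q_unit) (h - #|C|) (j - #|C|) #|C|.
have cF : #|freecol h j C| = (h - #|C|)%N.
  by apply: (@addIn #|C|); rewrite (card_freecol le_hn naC sC) subnK.
rewrite !subnK // => ->; rewrite -[X in gnum q X]cF mulrDr; congr (_ + _).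
  rewrite -sum_freecol mulrA mulrAC mulr_sumr.
  apply: eq_big => [s|s /andP[sL _]]; first by rewrite [RHS]inE.
  rewrite (inv_col1 onB sC sL) cardsU1 (notin_col sC sL) add1n subSS subnS
    exprD.
  by rewrite mulrAC.
by rewrite (inv_col onB sC) exprD subSn // mulrA cF.
Qed.

(* The point after h row steps and j column steps lies on the boundary of B. *)
Definition onpath h j := [/\ (h <= n)%N, (j <= n)%N,
  forall s, (s.1 < h)%N -> (j <= s.2)%N -> s \in B &
  forall s, (h <= s.1)%N -> (s.2 < j)%N -> s \notin B].

Lemma onpath_row (h : 'I_n) j : onpath h j -> [disjoint rowline h j & B].
Proof.
move=> [_ _ _ offB]; rewrite disjoint_subset; apply/subsetP => s.
by rewrite inE => /andP[/eqP s1 lt_sj]; apply: offB; rewrite ?s1.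
Qed.

Lemma onpath_col h (j : 'I_n) : onpath h j -> colline h j \subset B.
Proof.
move=> [_ _ onB _]; apply/subsetP => s.
by rewrite inE => /andP[lt_sh /eqP s2]; apply: onB; rewrite ?s2.
Qed.

(** For positive [h] and [j] the last step is read off the square in row [h.-1] and column [j.-1].
    If it is on the board, so is everything above and to the right of it, and a column was crossed;
    if not, everything below and to the left is off the board, and a row was crossed. *)
Lemma onpath_pred h j : ferrers B -> onpath h j ->
  [\/ (h = 0%N /\ j = 0%N), (exists2 h' : 'I_n, h = h'.+1 & onpath h' j)
    | (exists2 j' : 'I_n, j = j'.+1 & onpath h j')].
Proof.
move=> ferB [le_hn le_jn onB offB].
case: h j le_hn le_jn onB offB => [|h] [|j] lt_hn lt_jn onB offB.
- by constructor 1.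
- constructor 3; exists (Ordinal lt_jn) => //=; split=> //; first exact: ltnW.
  by move=> s ? lt_sj; apply: offB => //; apply: ltnW.
- constructor 2; exists (Ordinal lt_hn) => //=; split=> //; first exact: ltnW.
  by move=> s lt_sh ?; apply: onB => //; apply: ltnW.
pose i := Ordinal lt_hn; pose p := Ordinal lt_jn.
case: (boolP ((i, p) \in B)) => ipB.
  constructor 3; exists p => //=; split=> //; first exact: ltnW.
    move=> [k l] /= lt_kh le_jl; exact: (ferB _ _ _ _ ipB).
  by move=> s ? lt_sj; apply: offB => //; apply: ltnW.
constructor 2; exists i => //=; split=> //; first exact: ltnW.
  by move=> s lt_sh ?; apply: onB => //; apply: ltnW.
move=> [k l] /= le_hk lt_lj; apply: contra ipB => klB.
exact: (ferB _ _ _ _ klB).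
Qed.

Lemma rect00 : rect n 0 0 = set0.
Proof. by apply/setP => s; rewrite !inE. Qed.

Lemma nonattacking0 : nonattacking (set0 : {set square n}).
Proof. by apply/nonattackingP => r r'; rewrite inE. Qed.

Lemma stat00 : stat 0 0 set0 B = 0.
Proof.
rewrite /stat rect00 set0I setI0 big_set0 cards0.
have /eqP -> : skipped 0 0 set0 B == set0.
  by rewrite -subset0 -rect00 skipped_sub.
have -> : passed set0 B = set0.
  by apply/setP => s; rewrite !inE exists_in_eq0 // => r; rewrite !inE.
by rewrite cards0.
Qed.

Lemma fullgen00 : fullgen 0 0 = rookgen 0 0.
Proof.
apply: functional_extensionality => c; rewrite /fullgen /rookgen rect00 setI0.
rewrite [RHS](big_pred1 set0) => [|C]; last first.
  rewrite /= subset0 andbT; case: eqP => [->|_]; rewrite ?andbF //.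
  by rewrite nonattacking0.
have -> : Defs.inv (set0 : {set square n}) set0 = 0%N.
  by apply/eqP; rewrite cards_eq0; apply/eqP/setP => s; rewrite !inE.
rewrite cards0 /= /dirac mul1r.
rewrite (eq_bigl (fun C => (C == set0) && (c == 0%N))) => [|C]; last first.
  rewrite subset0; case: eqP => [->|_]; rewrite ?andbF //.
  by rewrite nonattacking0 cards0.
case: c => [|c] /=; last by rewrite big_pred0 // => C; rewrite andbF.
rewrite (big_pred1 set0) => [|C]; last by rewrite andbT.
by rewrite /weight stat00 set0I cards0 mulr1.
Qed.

Lemma fullgen_rookgen h j : ferrers B -> onpath h j -> fullgen h j = rookgen h
  j.
Proof.
move=> ferB; have [m] := ubnP (h + j); elim: m h j => // m IH h j lt_hjm on_hj.
have [_ le_jn _ _] := on_hj; have [le_hn _ _ _] := on_hj.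
case: (onpath_pred ferB on_hj) => [[-> ->]|[h' Eh on']|[j' Ej on']].
- exact: fullgen00.
- have off := onpath_row on'.
  rewrite Eh fullgen_row // rookgen_row // IH //.
  by move: lt_hjm; rewrite Eh addSn.
have sub := onpath_col on'.
rewrite Ej fullgen_col // rookgen_col // IH //.
by move: lt_hjm; rewrite Ej addnS.
Qed.

Lemma rectT : rect n n n = setT.
Proof. by apply/setP => s; rewrite !inE !ltn_ord. Qed.

(** The corner (n, n) ends the boundary path of every board, and entry 0 there means that no column
    is empty. On the other side [psi0] evaluates each term. *)
Lemma fullgen_full : ferrers B ->
  \sum_(C | nonattacking C && (#|C| == n)) weight n n C
  = \sum_(C | nonattacking C && (C \subset B))
      q ^+ Defs.inv C B
      * (\prod_(i < n - #|C|) gnum q i.+1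
         * \prod_((n - #|C|).+1 <= i < n.+1) (x - q ^+ i)).
Proof.
move=> ferB.
have on : onpath n n.
  by split=> // s; [move=> _; rewrite leqNgt ltn_ord | rewrite leqNgt ltn_ord].
have := congr1 (fun f => f 0%N) (fullgen_rookgen ferB on).
rewrite /fullgen /rookgen rectT setIT.
rewrite (eq_bigl (fun C => nonattacking C && (#|C| == n))) => [->|C];
  last first.
  by rewrite subsetT addn0.
apply: eq_big => [C|C /and3P[naC sC _]]; first by rewrite andbT.
have le_Cn : (#|C| <= n)%N.
  by apply: (@card_rect_cols n n C) => //; rewrite rectT subsetT.
by rewrite psi0 subnK.
Qed.

End Transfer.

(** * The statistic on full placements *)

Section FullPlacement.

Variables (n : nat) (B C : {set square n}).
Hypotheses (ferB : ferrers B) (naC : nonattacking C) (cardC : #|C| = n).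

Lemma cols_full : [set r.2 | r in C] = setT.
Proof.
by apply/eqP; rewrite eqEcard subsetT cardsT card_ord card_cols // cardC /=.
Qed.

Lemma rook_col_inj : {in C &, injective snd}.
Proof.
move=> r r' rC r'C E; apply/eqP; apply: contraT => nr.
by have := nonattackingP _ naC _ _ rC r'C nr; rewrite E eqxx andbF.
Qed.

(** Each column holds exactly one rook, so rooks can index the columns. *)
Lemma card_by_column (A : {set square n}) :
  #|A| = (\sum_(r in C) #|[set s in A | s.2 == r.2]|)%N.
Proof.
rewrite -sum1_card (partition_big (fun s => s.2) predT) //=.
rewrite (eq_bigl (fun i => i \in [set r.2 | r in C])) => [|i];
  last by rewrite cols_full inE.
rewrite big_imset /=; last exact: rook_col_inj.
by apply: eq_bigr => r _; rewrite -sum1dep_card.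
Qed.

Lemma card_cols_le (j : 'I_n) : #|[set r in C | (r.2 <= j)%N]| = j.+1.
Proof.
rewrite -[RHS](@card_ord_lt n j.+1) //.
rewrite -(card_in_imset (f := snd)); last first.
  by move=> r r'; rewrite !inE => /andP[rC _] /andP[r'C _]; apply: rook_col_inj.
apply: eq_card => i; rewrite [RHS]inE ltnS; apply/imsetP/idP => [[r]|le_ij].
  by rewrite inE => /andP[_ ?] ->.
have : i \in [set r.2 | r in C] by rewrite cols_full inE.
by case/imsetP => r rC E; exists r => //; rewrite inE rC -E.
Qed.

(** If [r] is off the board, the column has no [passed] square, and [cross] and [skipped] split its
    [n] squares. If [r] is on the board, nothing is skipped; [r.2.+1] squares hold a rook or are to
    the right of one, and the remaining squares of [cross] are the passed ones. *)
Lemma cross_column (r : square n) : r \in C ->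
  (#|[set s in [set s : square n |
      [|| (s \in C) || [exists r in C, right_of s r],
          [exists r in C, above s r] && (s \in B)
        | [exists r in C, below s r && (r \notin B)]]] | s.2 == r.2]|
   + #|[set s in skipped n n C B | s.2 == r.2]|
  = (if r \in B then r.2.+1 else n) + #|[set s in passed C B | s.2 == r.2]|)%N.
Proof.
move=> rC.
have colE (P : pred (square n)) (s : square n) : s.2 = r.2 ->
    [exists r' in C, (s.2 == r'.2) && P r'] = P r.
  move=> s2; apply/existsP/idP => [[r' /and3P[r'C /eqP E]]|Pr].
    by rewrite (rook_col_inj rC r'C) // -s2.
  by exists r; rewrite rC s2 eqxx.
have colC (s : square n) : s.2 = r.2 -> (s \in C) = (s.1 == r.1).
  move=> s2; apply/idP/eqP => [sC|s1]; first by rewrite (rook_col_inj sC rC).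
  by rewrite (surjective_pairing s) s1 s2 -surjective_pairing.
have colB (s : square n) : s.2 = r.2 ->
    [exists r' in C, below s r' && (r' \notin B)] = (r.1 < s.1)%N && (r \notin
      B).
  move=> s2; rewrite -(@colE (fun r' : square n => (r'.1 < s.1)%N && (r' \notin
    B)) s s2).
  by apply: eq_exists_in => r' _; rewrite andbA.
case: (boolP (r \in B)) => rB; last first.
  have -> : [set s in passed C B | s.2 == r.2] = set0.
    apply/setP => s; rewrite inE [RHS]inE; apply/andP => -[/[swap] /eqP s2].
    rewrite inE => /andP[/existsP[r0 /andP[/setIP[r0C r0B] /andP[/eqP E _]]] _].
    by rewrite (rook_col_inj r0C rC) ?(negPf rB) // -E in r0B.
  rewrite cards0 addn0.
  have E : #|[set s : square n | s.2 == r.2]| = n.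
    have inj : injective (fun i : 'I_n => (i, r.2)) by move=> i i' [].
    rewrite -[RHS](card_ord n) -(card_imset _ inj).
    apply: eq_card => s; rewrite inE; apply/eqP/imsetP => [s2|[i _ ->//]].
    by exists s.1; rewrite // -s2 -surjective_pairing.
  rewrite -[RHS]E -[RHS](cardsID [set s | [|| (s \in C) || [exists r in C,
    right_of s r],
          [exists r in C, above s r] && (s \in B)
        | [exists r in C, below s r && (r \notin B)]]]).
  congr (_ + _)%N; apply: eq_card => s; rewrite ![in LHS]inE ![in RHS]inE.
    by rewrite andbC.
  case: (s.2 =P r.2) => s2; rewrite ?andbF // !andbT.
  rewrite colB // colC // (@colE (fun r' : square n => (s.1 < r'.1)%N)) //
    (@colE (fun r' : square n => (r'.1 < s.1)%N)) //.
  rewrite rB andbT !ltn_ord /= andbT -val_eqE /=.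
  move: (s \in B) [exists r0 in C, right_of s r0] => b e.
  by case: (ltngtP s.1 r.1); case: b; case: e.
(* A square of this column outside the board is strictly below [r], because the board contains [r]
   and everything above it. *)
have -> : [set s in skipped n n C B | s.2 == r.2] = set0.
  apply/setP => s; rewrite inE [RHS]inE; apply/andP => -[/[swap] /eqP s2].
  rewrite inE => /andP[/setDP[_ sB] /and3P[sC sN _]].
  have le_rs : (s.1 <= r.1)%N.
    rewrite leqNgt; apply: contra sN => lt_rs.
    by rewrite (@colE (fun r' : square n => (r'.1 < s.1)%N)).
  case/negP: sB; rewrite (surjective_pairing s) s2.
  by apply: (ferB _ le_rs (leqnn _)); rewrite -surjective_pairing.
(* The number [r.2.+1] is that of the rooks in columns up to that of [r]; each is sent to the square
   where its row meets the column of [r]. *)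
rewrite cards0 addn0 -(card_cols_le r.2).
have injR : {in [set r' in C | (r'.2 <= r.2)%N] &, injective (fun r' => (r'.1,
  r.2))}.
  move=> r1 r2; rewrite !inE => /andP[r1C _] /andP[r2C _] [E].
  apply/eqP; apply: contraT => nr.
  by have := nonattackingP _ naC _ _ r1C r2C nr; rewrite E eqxx.
rewrite -(card_in_imset injR) -(cardsU_disj (subxx _)); last first.
  rewrite -setI_eq0; apply/eqP/setP => s; rewrite !inE.
  apply/andP => -[/imsetP[r']]; rewrite inE => /andP[r'C le_r'r] E.
  case/andP=> /andP[/existsP[r0 /andP[/setIP[r0C _] abv]] nright] _.
  have Er0 : r0 = r by apply: (rook_col_inj r0C rC);
    case/andP: abv => /eqP <- _; rewrite E.
  case/existsP: nright; exists r';
    rewrite r'C /right_of E eqxx /= ltn_neqAle le_r'r andbT.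
  apply/eqP => /val_inj E2; move: abv; rewrite /above Er0 E /=.
  by rewrite (rook_col_inj r'C rC E2) ltnn andbF.
congr #|pred_of_set _|; apply/setP => s;
  rewrite [LHS]inE in_setU [s \in [set _ in _ | _]]inE.
case: (s.2 =P r.2) => s2; last first.
  rewrite !andbF orbF; apply/esym/imsetP => -[r' _ E].
  by apply: s2; rewrite E.
rewrite !andbT !inE colB // rB andbF orbF.
have aE : [exists r0 in C, above s r0] = (s.1 < r.1)%N.
  by rewrite (@colE (fun r' : square n => (s.1 < r'.1)%N)).
have aBE : [exists r0 in C :&: B, above s r0] = (s.1 < r.1)%N.
  rewrite -aE; apply/existsP/existsP => -[r' /andP[r'C abv]]; exists r'.
    by rewrite abv andbT; case/setIP: r'C.
  rewrite abv andbT inE r'C; case/andP: abv => /eqP E _.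
  by rewrite (rook_col_inj r'C rC) // -s2.
have bE : (s.1 < r.1)%N -> s \in B.
  move=> lt_sr; rewrite (surjective_pairing s) s2.
  by apply: (ferB _ (ltnW lt_sr) (leqnn _)); rewrite -surjective_pairing.
have RE : (s \in C) || [exists r0 in C, right_of s r0]
        = (s \in [set (r'.1, r.2) | r' in [set r' in C | (r'.2 <= r.2)%N]]).
  apply/orP/imsetP => [[sC|/existsP[r' /andP[r'C /andP[/eqP E1 lt_r's]]]]|[r']].
  - exists s; first by rewrite inE sC s2 /=.
    by rewrite -s2 -surjective_pairing.
  - exists r'; first by rewrite inE r'C -s2 ltnW.
    by rewrite -E1 -s2 -surjective_pairing.
  rewrite inE => /andP[r'C]; rewrite leq_eqVlt => /orP[/eqP/val_inj E2 E|lt_r'r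
    E].
    by left; rewrite E -E2 -surjective_pairing.
  by right; apply/existsP; exists r'; rewrite r'C /right_of E eqxx.
rewrite aE aBE RE.
rewrite -RE; move: bE; case: (s.1 < r.1)%N => /= [->//|_]; rewrite ?orbF //.
by case: (s \in C); case: [exists r0 in C, right_of s r0].
Qed.

(** Summing [cross_column] over the rooks gives [E]; the rooks off the board contribute $n(n-k)$,
    which cancels the same term of [mat]. *)
Lemma mat_stat : mat C B = stat n n C B.
Proof.
have cD : (#|C :&: B| + #|C :\: B| = n)%N by rewrite cardsID.
have E : (cross C B + #|skipped n n C B|
    = n * #|C :\: B| + (\sum_(s in C :&: B) s.2.+1 + #|passed C B|))%N.
  rewrite /cross (card_by_column [set s | _]) (card_by_column (skipped _ _ _
    _)).
  rewrite (card_by_column (passed _ _)) -big_split /= (eq_bigr _ cross_column).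
  rewrite big_split /= addnA; congr (_ + _)%N.
  rewrite (big_setID B) /= addnC; congr (_ + _)%N.
    rewrite (eq_bigr (fun=> n)) => [|r /setDP[_ rB]];
      last by rewrite (negPf rB).
    by rewrite sum_nat_const mulnC.
  by apply: eq_bigr => r /setIP[_ ->].
rewrite /stat /mat rectT setIT.
have -> : n%:Z - #|C :&: B|%:Z = #|C :\: B|%:Z.
  by rewrite -[X in Posz X - _]cD PoszD addrC addKr.
move/(congr1 Posz): E; rewrite !PoszD PoszM => E.
have -> : (cross C B)%:Z = (cross C B)%:Z + #|skipped n n C B|%:Z - #|skipped n
  n C B|%:Z.
  by rewrite addrK.
by rewrite E; ring.
Qed.

End FullPlacement.

(** * q-hit polynomials *)

Lemma q_neq0 : q != 0.
Proof. by rewrite /q tofrac_eq0 polyX_eq0. Qed.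

Lemma q_neq1 : 1 - q != 0.
Proof.
rewrite /q -tofrac1 -tofracB tofrac_eq0 subr_eq0.
by apply/eqP => /(congr1 (fun p : {poly rat} => p`_0)); rewrite coef1 coefX.
Qed.

Lemma qnumE m : qnum m = gnum q m.
Proof.
rewrite /qnum; apply: (mulIf q_neq1).
by rewrite divfK ?q_neq1 // exprq_gnum; ring.
Qed.

Lemma gnumC m : gnum (q%:P) m = (qnum m)%:P.
Proof.
by rewrite qnumE /gnum rmorph_sum; apply: eq_bigr => i _; rewrite rmorphXn.
Qed.

Lemma qC_unit : q%:P \is a GRing.unit.
Proof. by rewrite rmorph_unit // unitfE q_neq0. Qed.

Lemma qfactC k : \prod_(i < k) gnum (q%:P) i.+1 = (qfact k)%:P.
Proof.
rewrite /qfact big_add1 /= big_mkord rmorph_prod /=.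
by apply: eq_bigr => i _; rewrite gnumC.
Qed.

Lemma card_nonattacking n (C : {set square n}) : nonattacking C -> (#|C| <=
  n)%N.
Proof. by move=> naC; apply: (@card_rect_cols n n n) => //;
  rewrite rectT subsetT. Qed.

(** Grouping by $n - |C|$ reproduces the indexing of [qhit_gen], where $[k]!$ goes with
    $R_{n-k}$. *)
Lemma sum_rook_number (V : nmodType) n (B : {set square n}) (F : {set square n}
  -> V) :
  \sum_(C | nonattacking C && (C \subset B)) F C
  = \sum_(i < n.+1) \sum_(C : {set square n} | [&& C \subset B, #|C| == (n -
    i)%N & nonattacking C]) F C.
Proof.
rewrite (partition_big (fun C : {set square n} => inord (n - #|C|) : 'I_n.+1)
  predT) //=.
apply: eq_bigr => i _; apply: eq_bigl => C.
case: (boolP (nonattacking C)) => naC; last by rewrite !andbF.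
rewrite /= andbT; congr (_ && _).
rewrite -val_eqE /= inordK ?ltnS ?leq_subr //.
apply/eqP/eqP => [<-|->]; rewrite subKn //; first exact: card_nonattacking.
by rewrite -ltnS.
Qed.

(** This is [fullgen_full] over [{poly Qq}], with ['X] for [x] and the constant polynomial [q%:P], a
    unit, for [q]. *)
Lemma qhit_gen_weight n (B : {set square n}) : ferrers B ->
  qhit_gen B
  = \sum_(C | nonattacking C && (#|C| == n)) weight (q%:P) 'X B n n C.
Proof.
move=> ferB; rewrite (fullgen_full _ qC_unit ferB) sum_rook_number.
rewrite /qhit_gen [LHS]big_mkord; apply: eq_bigr => i _.
rewrite /qrook [X in X *: _]mulr_sumr scaler_suml;
  apply: eq_bigr => C /and3P[_ /eqP cC _].
have -> : (n - #|C|)%N = i by rewrite cC subKn // -ltnS.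
rewrite qfactC -mul_polyC polyCM rmorphXn.
rewrite mulrA [_ ^+ _ * (qfact i)%:P]mulrC; congr (_ * _).
by apply: eq_bigr => l _; rewrite rmorphXn.
Qed.

Theorem theorem2 (n : nat) (B : {set square n}) (k : nat)
    (n_gt0 : (0 < n)%N) (ferrersB : ferrers B) (k_le_n : (k <= n)%N) :
  qhit B k =
  \sum_(C : {set square n} | [&& nonattacking C, #|C| == n & #|C :&: B| == k])
    q ^ mat C B.
Proof.
rewrite /qhit qhit_gen_weight // coef_sum.
rewrite (eq_bigr (fun C => if #|C :&: B| == k then q ^ mat C B else 0)).
  by rewrite -big_mkcondr; apply: eq_bigl => C; rewrite andbA.
move=> C /andP[naC /eqP cC]; rewrite /weight (mat_stat ferrersB naC cC).
(* The integer power of the constant polynomial is the constant polynomial of the power, so each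
   weight is a monomial whose degree is the number of rooks on the board. *)
rewrite -(rmorphXz polyC) ?unitfE ?q_neq0 //= coefCM coefXn eq_sym.
by case: eqP; rewrite ?mulr1 ?mulr0.
Qed.
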